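(* Let $X$ be a bounded Hadamard space and let $\{T_k\}_{k=1}^{m}$ be a commutative finite family of metrically nonspreading mappings of $X$ into itself (that is, $T_iT_j=T_jT_i$ for all $i,j\in\{1,\dots,m\}$). Then $\bigcap_{k=1}^{m}\mathcal{F}(T_k)$ is nonempty.
   Context: Metric spaces are understood to be nonempty, and $m$ is a positive integer. $\mathcal{F}(T)=\{u\in X : Tu=u\}$ denotes the set of all fixed points of $T$. A mapping $T$ of a metric space $(X,d)$ into itself is metrically nonspreading if $2d(Tx,Ty)^2 \leq d(Tx,y)^2 + d(Ty,x)^2$ for all $x,y\in X$. A metric space $X$ is uniquely geodesic if for all $x,y\in X$ there is a unique mapping $\gamma\colon[0,l]\to X$, $l=d(x,y)$, with $\gamma(0)=x$, $\gamma(l)=y$ and $d(\gamma(s),\gamma(t))=|s-t|$ for all $s,t\in[0,l]$; the point $\gamma(\alpha l)$ is denoted by $(1-\alpha)x\oplus\alpha y$ for $\alpha\in[0,1]$. A $\mathrm{CAT}(0)$ space is a uniquely geodesic metric space such that $d((1-\alpha)x\oplus\alpha y,(1-\beta)x\oplus\beta z)\leq |(1-\alpha)\bar x+\alpha\bar y-((1-\beta)\bar x+\beta\bar z)|_{\mathbb{R}^2}$ whenever $x,y,z\in X$, $\alpha,\beta\in[0,1]$ and $\bar x,\bar y,\bar z\in\mathbb{R}^2$ satisfy $d(x,y)=|\bar x-\bar y|_{\mathbb{R}^2}$, $d(y,z)=|\bar y-\bar z|_{\mathbb{R}^2}$, $d(z,x)=|\bar z-\bar x|_{\mathbb{R}^2}$,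 where $|\cdot|_{\mathbb{R}^2}$ is the Euclidean norm. An Hadamard space is a complete $\mathrm{CAT}(0)$ space. *)

(* Defs.v *)
From HB Require Import structures.
From mathcomp Require Import all_boot all_order all_algebra.
From mathcomp Require Import all_classical all_reals all_analysis.

Set Implicit Arguments.
Unset Strict Implicit.
Unset Printing Implicit Defensive.

Import Order.TTheory GRing.Theory Num.Theory.
Import numFieldNormedType.Exports.

Local Open Scope classical_set_scope.
Local Open Scope ring_scope.

(* [Complete] requires [isPointed], so these spaces are nonempty. *)
#[short(type="completeMetricType")]
HB.structure Definition CompleteMetric (R : numDomainType) :=
  {X of Metric R X & Complete X}.

Section Metric_notions.
Context {R : realType}.

Definition bounded_space (X : metricType R) : Prop :=
  exists M : R, forall x y : X, mdist x y <= M.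

(* A map [0, l] -> X is encoded as a total map R -> X whose values outside
   [0, l] are irrelevant. *)
Definition is_geodesic (X : metricType R) (x y : X) (g : R -> X) : Prop :=
  [/\ g 0 = x, g (mdist x y) = y &
      {in `[0, mdist x y] &, forall s t : R, mdist (g s) (g t) = `|s - t|}].

Definition uniquely_geodesic (X : metricType R) : Prop :=
  forall x y : X, exists2 g : R -> X, is_geodesic x y g &
    forall h : R -> X, is_geodesic x y h -> {in `[0, mdist x y], g =1 h}.

Definition geodesic (X : metricType R) (x y : X) : R -> X :=
  xget (fun=> x) [set g | is_geodesic x y g].

(* The point (1 - a) x (+) a y; meaningful for [a] in [0, 1] when [X] is
   uniquely geodesic. *)
Definition geocomb (X : metricType R) (a : R) (x y : X) : X :=
  geodesic x y (a * mdist x y).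

(* The library norm on ['rV[R]_2] is the sup norm. *)
Definition enorm (v : 'rV[R]_2) : R := Num.sqrt (\sum_(i < 2) v ord0 i ^+ 2).

Definition CAT0 (X : metricType R) : Prop :=
  uniquely_geodesic X /\
  forall (x y z : X) (a b : R) (x' y' z' : 'rV[R]_2),
    a \in `[0, 1] -> b \in `[0, 1] ->
    mdist x y = enorm (x' - y') ->
    mdist y z = enorm (y' - z') ->
    mdist z x = enorm (z' - x') ->
    mdist (geocomb a x y) (geocomb b x z) <=
      enorm (((1 - a) *: x' + a *: y') - ((1 - b) *: x' + b *: z')).

Definition Hadamard (X : completeMetricType R) : Prop := CAT0 X.

Definition metrically_nonspreading (X : metricType R) (T : X -> X) : Prop :=
  forall x y : X,
    2 * mdist (T x) (T y) ^+ 2 <= mdist (T x) y ^+ 2 + mdist (T y) x ^+ 2.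

End Metric_notions.

Definition fixed_points (X : Type) (T : X -> X) : set X := [set u | T u = u].

(* Main.v *)
Require Import Defs.
From mathcomp Require Import all_boot all_order all_algebra.
From mathcomp Require Import all_classical all_reals all_analysis.
From mathcomp Require Import ring lra.

(** In a CAT(0) space the midpoint [m] of [x] and [y] satisfies the
    Bruhat-Tits inequality
      d(m, z)^2 <= d(x, z)^2 / 2 + d(y, z)^2 / 2 - d(x, y)^2 / 4
    ([midpoint_CN]): compare with a Euclidean triangle, where this is an
    equality.  Everything else follows from this inequality.

    The case of one mapping [T] leaving invariant a nonempty closed convex set
    [C].  Take an orbit [u n] of [T] in [C] and let [r y] be the upper limit of
    [d (u n) y ^+ 2].  Passing to the upper limit in the inequality, [r]
    inherits its uniform convexity; as [r] is also Lipschitz continuous on a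
    bounded space, it attains its minimum on [C] ([minimizer_exists]), and only
    at one point [z].  The nonspreading inequality at [u n] and [y] reads
      2 d(u (n+1), T y)^2 <= d(u (n+1), y)^2 + d(T y, u n)^2,
    whose upper limit is [2 r (T y) <= r y + r (T y)].  Hence [r (T z) <= r z],
    and [T z = z] by uniqueness ([nonspreading_fixed_point]).

    Several mappings.  The fixed point set of a nonspreading mapping is closed
    and convex ([fixed_points_closed], [fixed_points_midpoint_convex]), and by
    commutativity it is invariant under the other mappings; so the mappings are
    added one at a time, with [C] the common fixed point set of the previous
    ones. *)

Import Order.TTheory GRing.Theory Num.Theory.

Local Open Scope classical_set_scope.
Local Open Scope ring_scope.

(** * Comparison triangles *)

Section Euclidean_plane.
Context {R : realType}.

Lemma enorm_sqr (v : 'rV[R]_2) :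
  enorm v ^+ 2 = v ord0 ord0 ^+ 2 + v ord0 ord_max ^+ 2.
Proof.
rewrite /enorm sqr_sqrtr; last by apply: sumr_ge0 => i _; exact: sqr_ge0.
by rewrite big_ord_recr big_ord1 /=; congr (v _ _ ^+ _ + _); apply: val_inj.
Qed.

Let vec (a b : R) : 'rV[R]_2 := \row_(i < 2) (if i == ord0 then a else b).

Let enorm_vecB (a b c d p : R) : 0 <= p ->
  p ^+ 2 = (a - c) ^+ 2 + (b - d) ^+ 2 -> p = enorm (vec a b - vec c d).
Proof.
move=> p0 pE; apply/eqP; rewrite -(eqrXn2 (n := 2)) ?sqrtr_ge0 // pE.
by rewrite enorm_sqr !mxE.
Qed.

(** The CAT(0) condition speaks only of triples that already have a comparison
    triangle in the plane, so such triangles must be produced to exploit it. *)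
Lemma comparison_triangle (p q r : R) : 0 <= p -> 0 <= q -> 0 <= r ->
  p <= q + r -> q <= r + p -> r <= p + q ->
  exists x y z : 'rV[R]_2,
    [/\ p = enorm (x - y), q = enorm (y - z) & r = enorm (z - x)].
Proof.
move=> p0 q0 r0 pqr qrp rpq; have [p_eq0|p_neq0] := eqVneq p 0.
  (* A degenerate triangle, where the law of cosines would divide by 0. *)
  have qr : q = r by apply: le_anti; apply/andP; split; lra.
  by exists (vec 0 0), (vec 0 0), (vec r 0); split; apply: enorm_vecB => //;
     rewrite ?qr ?p_eq0; ring.
(* The law of cosines gives the first coordinate of the third vertex. *)
pose s : R := (r ^+ 2 + p ^+ 2 - q ^+ 2) / (2 * p).
have sE : 2 * p * s = r ^+ 2 + p ^+ 2 - q ^+ 2 by rewrite /s; field.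
have p_gt0 : 0 < p by rewrite lt_def p_neq0.
have s_le : s <= r.
  rewrite -(ler_pM2l (_ : 0 < 2 * p)); last by lra.
  by rewrite sE; nra.
have s_ge : - r <= s.
  rewrite -(ler_pM2l (_ : 0 < 2 * p)); last by lra.
  by rewrite sE; nra.
have t_ge0 : 0 <= r ^+ 2 - s ^+ 2 by nra.
have tE := sqr_sqrtr t_ge0.
exists (vec 0 0), (vec p 0), (vec s (Num.sqrt (r ^+ 2 - s ^+ 2))).
by split; apply: enorm_vecB => //; rewrite ?subr0 ?sub0r ?sqrrN ?tE; nra.
Qed.

End Euclidean_plane.

(** * Midpoints in CAT(0) spaces *)

Section Midpoints.
Context {R : realType}.

Definition midpoint {X : metricType R} (x y : X) : X := geocomb 2^-1 x y.

(** For closed sets in a complete CAT(0) space, this is geodesic convexity. *)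
Definition midpoint_convex {X : metricType R} (C : set X) : Prop :=
  forall x y, C x -> C y -> C (midpoint x y).

Lemma geocomb1 {X : metricType R} (x y : X) :
  uniquely_geodesic X -> geocomb 1 x y = y.
Proof.
move=> /(_ x y)[g gxy _]; rewrite /geocomb mul1r /geodesic.
by have [] := xgetPex (fun=> x) (ex_intro [set h | is_geodesic x y h] g gxy).
Qed.

(** The CAT(0) comparison between the midpoint of [x], [y] and the endpoint [z]
    of the other side, followed by the parallelogram law in the plane. *)
Lemma midpoint_CN {X : metricType R} (x y z : X) : CAT0 X ->
  mdist (midpoint x y) z ^+ 2 <=
    2^-1 * mdist x z ^+ 2 + 2^-1 * mdist y z ^+ 2 - 4^-1 * mdist x y ^+ 2.
Proof.
move=> [Xgeo Xcat].
have xyz := metric_triangle x y z; have xzy := metric_triangle x z y.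
have yxz := metric_triangle y x z.
rewrite (metric_sym x z) in xyz xzy; rewrite (metric_sym z y) in xzy.
rewrite (metric_sym y x) (metric_sym x z) in yxz.
have [||||||x' [y' [z' [xy yz zx]]]] :=
  @comparison_triangle R (mdist x y) (mdist y z) (mdist z x);
  rewrite ?mdist_ge0 //; try by lra.
have half01 : (2^-1 : R) \in `[0, 1].
  by rewrite in_itv /=; apply/andP; split; lra.
have one01 : (1 : R) \in `[0, 1] by rewrite in_itv /= ler01 lexx.
have := Xcat _ _ _ _ _ _ _ _ half01 one01 xy yz zx.
rewrite geocomb1 // => le_mz.
apply: (@le_trans _ _ (enorm (((1 - 2^-1) *: x' + 2^-1 *: y') -
   ((1 - 1) *: x' + 1 *: z')) ^+ 2)).
  by rewrite lerXn2r // nnegrE ?mdist_ge0 // sqrtr_ge0.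
rewrite (metric_sym x z) xy yz zx !enorm_sqr !mxE.
by lra.
Qed.

End Midpoints.

(** * Minimizing uniformly convex functions *)

Section Minimization.
Context {R : realType}.

(** If [f] is within [d] of its infimum over [C] at two points of [C], then the
    square of their distance is at most [4 * d], since otherwise [f] would fall
    below the infimum at their midpoint.  So the sublevel sets of [f] in [C]
    form a Cauchy filter, and its limit is the minimizer. *)
Lemma minimizer_exists {X : completeMetricType R} (C : set X) (f : X -> R)
    (K : R) :
  C !=set0 -> closed C -> midpoint_convex C ->
  (forall x, 0 <= f x) ->
  (forall x y, f y <= f x + K * mdist x y) ->
  (forall x y, f (midpoint x y) <=
     2^-1 * f x + 2^-1 * f y - 4^-1 * mdist x y ^+ 2) ->
  exists2 z, C z & forall y, C y -> f z <= f y.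
Proof.
move=> [c Cc] Ccl Cmid f_ge0 f_lip f_conv.
pose I := inf (f @` C).
have fC_inf : has_inf (f @` C).
  by split; [exists (f c), c|exists 0 => _ [x _ <-]].
have I_le x : C x -> I <= f x.
  by move=> Cx; apply: ge_inf; [case: fC_inf|exists x].
pose S e := [set x | C x /\ f x < I + e].
have S_nonempty e : 0 < e -> S e !=set0.
  by move=> e0; have [_ [x Cx <-] fx] := inf_adherent e0 fC_inf; exists x.
pose F := filter_from [set e : R | 0 < e] S.
have FF : ProperFilter F.
  apply: filter_from_proper => //; apply: filter_from_filter.
    by exists 1 => /=; lra.
  move=> e1 e2 /= e1_gt0 e2_gt0; exists (Num.min e1 e2).
    by rewrite /= lt_min e1_gt0.
  by move=> x [Cx fx]; split; split => //; apply: (lt_le_trans fx);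
    rewrite lerD2l ge_min lexx ?orbT.
have Fcauchy : cauchy F.
  apply: cauchy_exP => e /= e0.
  have d0 : 0 < 4^-1 * e ^+ 2 by rewrite mulr_gt0 ?exprn_gt0 // invr_gt0; lra.
  have [x [Cx fx]] := S_nonempty _ d0.
  exists x; exists (4^-1 * e ^+ 2) => // y [Cy fy].
  rewrite ballEmdist /=.
  have := le_trans (I_le _ (Cmid _ _ Cx Cy)) (f_conv x y) => I_conv.
  by rewrite -ltr_sqr ?nnegrE ?mdist_ge0 ?(ltW e0) //; lra.
pose z := lim F; have Fz : F --> z := @cauchy_cvg X F FF Fcauchy.
have meet e (B : set X) : 0 < e -> nbhs z B -> S e `&` B !=set0.
  move=> e0 zB; apply: (@filter_ex _ F); apply: filterI; last exact: Fz.
  by exists e.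
exists z.
  by apply: Ccl => B /(meet 1 _ ltr01)[x [[Cx _] Bx]]; exists x.
move=> y Cy; apply: le_trans (I_le _ Cy); apply/ler_addgt0Pr => e e0.
have K0 : 0 < `|K| + 1 by have := normr_ge0 K; lra.
have e2 : 0 < e / 2 by lra.
have e'0 : 0 < e / 2 / (`|K| + 1) by rewrite divr_gt0.
have [x [[Cx fx]]] := meet _ _ e2 (nbhsx_ballx z _ e'0).
rewrite ballEmdist /= ltr_pdivlMr // metric_sym => zx.
have := f_lip x z; have := ler_norm K; have := mdist_ge0 x z.
by nra.
Qed.

End Minimization.

(** * Asymptotic radii of bounded sequences *)

Section Asymptotic_radius.
Context {R : realType} {X : metricType R}.
Implicit Type u : nat -> X.

(** For [u] bounded, the upper limit of [mdist (u n) y ^+ 2], as the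
    infimum of its eventual upper bounds: estimates between distances then pass
    to the limit directly, within the real numbers. *)
Definition asymptotic_radius2 u (y : X) : R :=
  inf [set a | \forall n \near \oo, mdist (u n) y ^+ 2 <= a].

Lemma asymptotic_radius2_le u (y : X) (a : R) :
  (\forall n \near \oo, mdist (u n) y ^+ 2 <= a) ->
  asymptotic_radius2 u y <= a.
Proof.
move=> ya; apply: ge_inf => //; exists 0 => b /filter_ex[n].
exact/le_trans/sqr_ge0.
Qed.

Let bounds_nonempty u (y : X) : bounded_space X ->
  [set a | \forall n \near \oo, mdist (u n) y ^+ 2 <= a] !=set0.
Proof.
move=> [M dM]; exists (M ^+ 2); apply: nearW => n.
by rewrite lerXn2r // nnegrE ?mdist_ge0 // (le_trans _ (dM y y)) ?mdist_ge0.
Qed.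

Lemma asymptotic_radius2_lt u (y : X) (a : R) : bounded_space X ->
  asymptotic_radius2 u y < a ->
  \forall n \near \oo, mdist (u n) y ^+ 2 <= a.
Proof.
move=> Xbd /inf_lt[|b yb ba]; first exact: bounds_nonempty.
by apply: filterS yb => n /le_trans; apply; exact: ltW.
Qed.

Lemma asymptotic_radius2_ge0 u (y : X) : bounded_space X ->
  0 <= asymptotic_radius2 u y.
Proof.
move=> Xbd; apply: lb_le_inf => [|b /filter_ex[n]].
  exact: bounds_nonempty.
exact/le_trans/sqr_ge0.
Qed.

Lemma asymptotic_radius2_lipschitz (M : R) u (x y : X) :
  (forall x y : X, mdist x y <= M) ->
  asymptotic_radius2 u y <= asymptotic_radius2 u x + 3 * M * mdist x y.
Proof.
move=> dM; have Xbd : bounded_space X by exists M.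
apply/ler_addgt0Pr => e e0.
have /(asymptotic_radius2_lt _ _ _ Xbd) xe : asymptotic_radius2 u x <
  asymptotic_radius2 u x + e by rewrite ltrDl.
apply: asymptotic_radius2_le; apply: filterS xe => n.
have := metric_triangle (u n) x y; have := dM (u n) x; have := dM x y.
have := mdist_ge0 (u n) x; have := mdist_ge0 x y; have := mdist_ge0 (u n) y.
move: (asymptotic_radius2 u x) => r.
move: (mdist (u n) x) (mdist (u n) y) (mdist x y) => a b d b0 d0 a0 dleM aM bad.
move=> ar.
(* (a + d)^2 = a^2 + (2 a + d) d, and both a and d are at most M. *)
have : b ^+ 2 <= (a + d) ^+ 2 by rewrite lerXn2r // nnegrE; lra.
have : a * d <= M * d by rewrite ler_wpM2r.
have : d * d <= M * d by rewrite ler_wpM2r.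
by lra.
Qed.

Lemma asymptotic_radius2_midpoint u (x y : X) : bounded_space X -> CAT0 X ->
  asymptotic_radius2 u (midpoint x y) <=
    2^-1 * asymptotic_radius2 u x + 2^-1 * asymptotic_radius2 u y
      - 4^-1 * mdist x y ^+ 2.
Proof.
move=> Xbd Xcat; apply/ler_addgt0Pr => e e0.
have /(asymptotic_radius2_lt _ _ _ Xbd) xe : asymptotic_radius2 u x <
  asymptotic_radius2 u x + e by rewrite ltrDl.
have /(asymptotic_radius2_lt _ _ _ Xbd) ye : asymptotic_radius2 u y <
  asymptotic_radius2 u y + e by rewrite ltrDl.
apply: asymptotic_radius2_le; apply: filterS2 xe ye => n.
have := midpoint_CN x y (u n) Xcat.
rewrite !(metric_sym _ (u n)); lra.
Qed.

(** This is where nonspreading enters: along an orbit the inequality involves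
    only squared distances to [y] and to [T y], and the shift of index is
    invisible to an upper limit. *)
Lemma asymptotic_radius2_orbit (T : X -> X) (x y : X) :
  bounded_space X -> metrically_nonspreading T ->
  asymptotic_radius2 (fun n => iter n T x) (T y) <=
  asymptotic_radius2 (fun n => iter n T x) y.
Proof.
move=> Xbd Tns; set u := fun n => _.
apply/ler_addgt0Pr => e e0.
have /(asymptotic_radius2_lt _ _ _ Xbd) ye : asymptotic_radius2 u y <
  asymptotic_radius2 u y + e / 2 by rewrite ltrDl divr_gt0.
have /(asymptotic_radius2_lt _ _ _ Xbd) Tye : asymptotic_radius2 u (T y) <
  asymptotic_radius2 u (T y) + e / 2 by rewrite ltrDl divr_gt0.
(* The term [r (T y)] on the right has coefficient 1/2 and can be absorbed. *)
suff : asymptotic_radius2 u (T y) <=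
  2^-1 * (asymptotic_radius2 u y + e / 2) +
    2^-1 * (asymptotic_radius2 u (T y) + e / 2).
  by lra.
apply: asymptotic_radius2_le.
apply: near_inftyS.
have yeS : \forall n \near \oo,
    mdist (u n.+1) y ^+ 2 <= asymptotic_radius2 u y + e / 2.
  by case: ye => N _ yN; exists N => // n Nn; apply: yN; exact: leqW.
apply: filterS2 yeS Tye => n /=.
have := Tns (u n) y; rewrite (metric_sym (T y) (u n)); lra.
Qed.

End Asymptotic_radius.

(** * Fixed points of nonspreading mappings *)

Section Fixed_points.
Context {R : realType}.

(** This replaces nonexpansiveness: a nonspreading mapping may even be
    discontinuous, but the nonspreading inequality at a fixed point compares
    [d(T x, p)] with itself and with [d(x, p)] only. *)
Lemma nonspreading_fixed_le {X : metricType R} (T : X -> X) (p x : X) :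
  metrically_nonspreading T -> T p = p -> mdist (T x) p <= mdist x p.
Proof.
move=> Tns Tp; rewrite -ler_sqr ?nnegrE ?mdist_ge0 //.
have := Tns x p; rewrite Tp (metric_sym p x); lra.
Qed.

(** A fixed point close to [x] is just as close to [T x], which is therefore
    arbitrarily close to [x] when [x] is a limit of fixed points. *)
Lemma fixed_points_closed {X : metricType R} (T : X -> X) :
  metrically_nonspreading T -> closed (fixed_points T).
Proof.
move=> Tns x Fx; apply: mdist_positivity; apply/le_anti.
rewrite mdist_ge0 andbT; apply/ler_addgt0Pr => e e0; rewrite add0r.
have e2 : 0 < e / 2 by lra.
have [p [Tp]] := Fx _ (nbhsx_ballx x _ e2).
rewrite ballEmdist /= => xp.
have := nonspreading_fixed_le _ _ x Tns Tp.
have := metric_triangle (T x) p x; rewrite (metric_sym p x); lra.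
Qed.

(** For [m] the midpoint of two fixed points [x] and [y], the image [T m] is at
    distance at most [d(x, y) / 2] from both; the Bruhat-Tits inequality at
    [T m] leaves no room for it to differ from [m]. *)
Lemma fixed_points_midpoint_convex {X : metricType R} (T : X -> X) :
  CAT0 X -> metrically_nonspreading T -> midpoint_convex (fixed_points T).
Proof.
move=> Xcat Tns x y Tx Ty; set m := midpoint x y.
have sqr_le a b : mdist a b ^+ 2 <= 0 -> a = b :> X.
  move=> ab; apply: mdist_positivity; apply/eqP; rewrite -sqrf_eq0.
  by rewrite eq_le ab sqr_ge0.
have le2 p : T p = p -> mdist p (T m) ^+ 2 <= mdist m p ^+ 2.
  move=> Tp; rewrite lerXn2r ?nnegrE ?mdist_ge0 // metric_sym.
  exact: nonspreading_fixed_le.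
apply/esym; apply: sqr_le.
have := midpoint_CN x y (T m) Xcat.
have := midpoint_CN x y x Xcat; have := midpoint_CN x y y Xcat.
rewrite -/m !mdistxx (metric_sym y x) expr0n /=.
have := le2 x Tx; have := le2 y Ty; lra.
Qed.

(** The set [C] is what makes the induction on the number of mappings possible:
    it will be the common fixed point set of the mappings already treated. *)
Lemma nonspreading_fixed_point {X : completeMetricType R} (C : set X)
    (T : X -> X) :
  bounded_space X -> CAT0 X -> metrically_nonspreading T ->
  C !=set0 -> closed C -> midpoint_convex C -> (forall x, C x -> C (T x)) ->
  (C `&` fixed_points T) !=set0.
Proof.
move=> Xbd Xcat Tns [c Cc] Ccl Cmid CT.
pose u n := iter n T c; have [M dM] := Xbd.
have [z Cz zmin] := minimizer_exists C (asymptotic_radius2 u) (3 * M)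
  (ex_intro _ c Cc) Ccl Cmid (fun x => asymptotic_radius2_ge0 u x Xbd)
  (fun x y => asymptotic_radius2_lipschitz M u x y dM)
  (fun x y => asymptotic_radius2_midpoint u x y Xbd Xcat).
exists z; split => //.
have := asymptotic_radius2_midpoint u (T z) z Xbd Xcat.
(* Comparing [z] with the midpoint of [T z] and [z] is uniqueness of the
   minimizer. *)
have := zmin _ (Cmid _ _ (CT _ Cz) Cz).
have := asymptotic_radius2_orbit T c z Xbd Tns; rewrite -/u => h1 h2 h3.
apply: mdist_positivity; apply/eqP; rewrite -sqrf_eq0 eq_le sqr_ge0 andbT.
lra.
Qed.

End Fixed_points.

Theorem theorem4p4 (R : realType) (X : completeMetricType R) (m : nat)
    (T : 'I_m -> X -> X) :
  (0 < m)%N ->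
  bounded_space X ->
  Hadamard X ->
  (forall k : 'I_m, metrically_nonspreading (T k)) ->
  (forall i j : 'I_m, T i \o T j = T j \o T i) ->
  \bigcap_(k in [set: 'I_m]) fixed_points (T k) !=set0.
Proof.
move=> _ Xbd Xcat Tns Tcomm.
suff [x xfix] : \bigcap_(k in [set` enum 'I_m]) fixed_points (T k) !=set0.
  by exists x => k _; apply: xfix; rewrite /= mem_enum.
elim: (enum 'I_m) => [|k s IHs]; first by exists point.
have [|||x [xs xk]] := nonspreading_fixed_point _ (T k) Xbd Xcat (Tns k) IHs.
- by apply: closed_bigI => i _; exact: fixed_points_closed.
- by move=> x y xs ys i si; apply: fixed_points_midpoint_convex;
    [|exact: Tns|exact: xs|exact: ys].
- move=> x xs i si; rewrite /fixed_points /=.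
  by have /(congr1 (@^~ x)) /= -> := Tcomm i k; rewrite xs.
exists x => i /=; rewrite inE => /orP[/eqP -> //|]; exact: xs.
Qed.
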